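(* Let $n$ and $\ell$ be positive integers with $\ell\leqslant\frac{n}{2}$, and let $G=K_\ell\cup K_{n-\ell}$ be the graph on $n$ vertices consisting of two complete components $K_\ell$ and $K_{n-\ell}$, so that it has $m=\binom{\ell}{2}+\binom{n-\ell}{2}$ edges. Assume $$\ell-\frac{2\ell^2}{n}\leqslant 1.$$ Then $G=K_\ell\cup K_{n-\ell}$ is a Largest Eigenvalue Global Minimizer (LEGM).
   Context: All graphs are simple, undirected and unweighted (no self loops, no multiple edges). The Laplacian of $G$ is $L(G)=D(G)-A(G)$, where $D(G)$ is the diagonal matrix of vertex degrees and $A(G)$ is the adjacency matrix; $\lambda_1(G)$ denotes the largest eigenvalue of $L(G)$. $K_r$ is the complete graph on $r$ vertices and $\cup$ denotes disjoint union of graphs. A graph $G$ with $n$ vertices and $m$ edges is a Largest Eigenvalue Global Minimizer (LEGM) if $\lambda_1(G)\leqslant\lambda_1(H)$ for every simple graph $H$ with $n$ vertices and $m$ edges. *)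

(* Defs.v *)
From HB Require Import structures.
From mathcomp Require Import all_boot all_order all_algebra.
From mathcomp Require Import polyrcf.
Set Implicit Arguments.
Unset Strict Implicit.
Unset Printing Implicit Defensive.
Import Order.TTheory GRing.Theory Num.Theory.
Local Open Scope ring_scope.

Record sgraph := SGraph {
  vertex :> finType;
  adj : rel vertex;
  adj_sym : symmetric adj;
  adj_irrefl : irreflexive adj
}.

Definition edges (G : sgraph) : {set {set G}} :=
  [set [set p.1; p.2] | p : G * G & adj p.1 p.2].

Definition degree (G : sgraph) (x : G) : nat := #|[set y | adj x y]|.

(* Row and column i of the matrices below stand for the vertex [enum_val i]. *)
Definition degree_mx (R : rcfType) (G : sgraph) : 'M[R]_#|G| :=
  diag_mx (\row_i (degree (enum_val i : G))%:R).

Definition adjacency_mx (R : rcfType) (G : sgraph) : 'M[R]_#|G| :=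
  \matrix_(i, j) (adj (enum_val i : G) (enum_val j))%:R.

Definition laplacian (R : rcfType) (G : sgraph) : 'M[R]_#|G| :=
  degree_mx R G - adjacency_mx R G.

(* [rootsR] lists the roots of a nonzero polynomial in increasing order; the
   value is meaningful only if A has an eigenvalue in R (see [lambda1P]). *)
Definition largest_eigenvalue (R : rcfType) (n : nat) (A : 'M[R]_n) : R :=
  last 0 (rootsR (char_poly A)).

Definition lambda1 (R : rcfType) (G : sgraph) : R :=
  largest_eigenvalue (laplacian R G).

Definition LEGM (R : rcfType) (G : sgraph) : Prop :=
  forall H : sgraph, #|H| = #|G| -> #|edges H| = #|edges G| ->
    lambda1 R G <= lambda1 R H.

Definition complete_rel (r : nat) : rel 'I_r := fun x y => x != y.

Lemma complete_sym r : symmetric (@complete_rel r).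
Proof. by move=> x y; rewrite /complete_rel eq_sym. Qed.

Lemma complete_irrefl r : irreflexive (@complete_rel r).
Proof. by move=> x; rewrite /complete_rel eqxx. Qed.

Definition complete_graph (r : nat) : sgraph :=
  SGraph (@complete_sym r) (@complete_irrefl r).

Definition union_rel (G H : sgraph) : rel (G + H)%type := fun x y =>
  match x, y with
  | inl a, inl b => adj a b
  | inr a, inr b => adj a b
  | _, _ => false
  end.

Lemma union_sym G H : symmetric (@union_rel G H).
Proof. by move=> [a|a] [b|b] //=; rewrite adj_sym. Qed.

Lemma union_irrefl G H : irreflexive (@union_rel G H).
Proof. by move=> [a|a] /=; rewrite adj_irrefl. Qed.

Definition disjoint_union (G H : sgraph) : sgraph :=
  SGraph (@union_sym G H) (@union_irrefl G H).

Lemma largest_eigenvalueP (R : rcfType) n (A : 'M[R]_n) (a : R) :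
  eigenvalue A a ->
  eigenvalue A (largest_eigenvalue A) /\
  (forall b, eigenvalue A b -> b <= largest_eigenvalue A).
Proof.
have p0 : char_poly A != 0 by apply: monic_neq0; apply: char_poly_monic.
have memE b : eigenvalue A b = (b \in rootsR (char_poly A)).
  by rewrite eigenvalue_root_char -roots_on_rootsR.
have srt : sorted <=%R (rootsR (char_poly A)).
  apply: (sub_sorted (e := <%R)); [by move=> x y /ltW | exact: sorted_roots].
rewrite memE /largest_eigenvalue => ain; split.
  by rewrite memE; case: (rootsR _) ain => // x s _ /=; rewrite mem_last.
move=> b; rewrite memE.
elim/last_ind: (rootsR _) srt {ain} => // s x _ srt.
rewrite last_rcons mem_rcons inE => /predU1P[-> //|bs].
by move: srt; rewrite (sorted_pairwise le_trans) pairwise_rcons => /andP[/allP/(_ _ bs)].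
Qed.

Lemma eigenvalue_laplacian0 (R : rcfType) (G : sgraph) :
  (0 < #|G|)%N -> eigenvalue (laplacian R G) 0.
Proof.
move=> G0; apply/eigenvalueP; exists (const_mx 1).
  rewrite scale0r; apply/rowP=> j; rewrite !mxE.
  under eq_bigr do rewrite !mxE mul1r.
  rewrite sumrB (bigD1 j) //= eqxx mulr1n big1 ?addr0; last first.
    by move=> i /negPf ->; rewrite mulr0n.
  apply/eqP; rewrite subr_eq0; apply/eqP.
  rewrite /degree -sum1dep_card natr_sum big_mkcond /=.
  rewrite (reindex (@enum_val G G)) /=; last first.
    by apply: onW_bij; exact: enum_val_bij.
  by apply: eq_bigr => i _; rewrite (adj_sym (enum_val i)); case: (adj _ _).
apply/eqP=> /rowP/(_ (Ordinal G0)); rewrite !mxE => /eqP.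
by rewrite oner_eq0.
Qed.

Lemma lambda1P (R : rcfType) (G : sgraph) : (0 < #|G|)%N ->
  eigenvalue (laplacian R G) (lambda1 R G) /\
  (forall a, eigenvalue (laplacian R G) a -> a <= lambda1 R G).
Proof. by move=> /(eigenvalue_laplacian0 R)/largest_eigenvalueP. Qed.

Lemma card_union G H : #|disjoint_union G H| = (#|G| + #|H|)%N.
Proof. exact: card_sum. Qed.

Lemma card_edges_complete r : #|edges (complete_graph r)| = 'C(r, 2).
Proof.
rewrite -[r in RHS]card_ord -card_draws.
apply: eq_card => e; rewrite [RHS]inE; apply/imsetP/cards2P.
  by case=> [[x y]]; rewrite inE => xy ->; exists x, y.
by case=> x [y [xy ->]]; exists (x, y); rewrite ?inE.
Qed.

Lemma card_edges_union G H :
  #|edges (disjoint_union G H)| = (#|edges G| + #|edges H|)%N.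
Proof.
set U := disjoint_union G H.
pose il (x : G) : U := inl x; pose ir (x : H) : U := inr x.
pose fl (e : {set G}) : {set U} := il @: e.
pose fr (e : {set H}) : {set U} := ir @: e.
have injl : injective fl by apply: imset_inj => x y [].
have injr : injective fr by apply: imset_inj => x y [].
have flE x y : fl [set x; y] = [set il x; il y] by rewrite /fl imsetU1 imset_set1.
have frE x y : fr [set x; y] = [set ir x; ir y] by rewrite /fr imsetU1 imset_set1.
have -> : edges U = (fl @: edges G) :|: (fr @: edges H).
  apply/setP=> e; rewrite in_setU; apply/imsetP/orP.
    move=> [[[x|x] [y|y]]]; rewrite inE //= => xy ->; [left|right].
      by rewrite -[[set _; _]]flE imset_f //; apply/imsetP; exists (x, y); rewrite ?inE.
    by rewrite -[[set _; _]]frE imset_f //; apply/imsetP; exists (x, y); rewrite ?inE.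
  case=> /imsetP[f /imsetP[[x y]]]; rewrite inE /= => xy -> ->.
    by exists (il x, il y); rewrite ?inE // flE.
  by exists (ir x, ir y); rewrite ?inE // frE.
suff disj : (fl @: edges G) :&: (fr @: edges H) = set0.
  by rewrite cardsU disj cards0 subn0 (card_imset _ injl) (card_imset _ injr).
apply/setP=> e; rewrite in_setI in_set0; apply/negP => /andP[].
case/imsetP=> f /imsetP[[x y] _ ->] ->; rewrite flE.
case/imsetP=> g _ /setP/(_ (il x)); rewrite set21 => /esym/imsetP[z _].
by [].
Qed.

Lemma card_edges_two_complete k l :
  #|edges (disjoint_union (complete_graph k) (complete_graph l))|
  = ('C(k, 2) + 'C(l, 2))%N.
Proof. by rewrite card_edges_union !card_edges_complete. Qed.

(* Main.v *)
(* Every eigenvalue of L(K_l u K_(n-l)) is at most k := n - l, so it suffices to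
   show lambda_1(H) >= k for a competitor H.  The hypothesis says exactly that the
   average degree of H is at least k - 2.  Since lambda_1(H) >= Delta(H) + 1 when H
   has an edge, the bound holds as soon as Delta(H) >= k - 1.  Otherwise H is
   (k - 2)-regular and n (l - 1) = 2 l^2; then l - 1 divides 2, so
   (n, l) = (8, 2) or (9, 3), and H is 4-regular with k = 6.  These two cases
   follow from the cut bound n c(S) <= lambda_1 |S| |V \ S|, applied to a triangle
   or a 4-cycle of the complement of H. *)
Require Import Defs.
From mathcomp Require Import all_boot all_order all_algebra complex.
From mathcomp Require Import zify ring lra.
Set Implicit Arguments.
Unset Strict Implicit.
Unset Printing Implicit Defensive.
Import Order.TTheory GRing.Theory Num.Theory.
Local Open Scope ring_scope.

(** * Rayleigh quotients of symmetric matrices *)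

Lemma rayleigh_le (R : rcfType) (n : nat) (A : 'M[R]_n) (c : R) (x : 'rV_n) :
    A^T = A -> (forall b, eigenvalue A b -> b <= c) ->
  (x *m A *m x^T) 0 0 <= c * (x *m x^T) 0 0.
Proof.
move=> symA le_c.
(* A is diagonalised by a unitary matrix over R[i]; as A is Hermitian there, the
   diagonal entries are real, hence eigenvalues of A over R. *)
pose toC : {rmorphism R -> R[i]} := real_complex R.
have conj_toC m (y : 'rV[R]_m) : map_mx Num.conj (map_mx toC y)^T = map_mx toC y^T.
  by apply/matrixP => i j; rewrite !mxE; apply: conj_Creal; rewrite complex_real.
pose AC := map_mx toC A.
have hermAC : AC \is hermsymmx.
  apply: realsym_hermsym.
    by apply/is_hermitianmxP; rewrite expr0 scale1r map_mx_id // /AC map_trmx symA.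
  by apply/mxOverP => i j; rewrite mxE complex_real.
have /orthomx_spectralP := hermitian_normalmx hermAC.
set P := spectralmx AC; set d := spectral_diag AC => defAC.
have uP : P \is unitarymx by exact: spectral_unitarymx.
have invP : invmx P = map_mx Num.conj P^T by exact: invmx_unitary.
have unitP : P \in unitmx by exact: unitarymx_unit.
have d_le i : d 0 i <= toC c.
  have /mxOverP/(_ 0 i) := hermitian_spectral_diag_real hermAC.
  rewrite -/d => /complex_realP[a da].
  rewrite da lecR; apply: le_c.
  rewrite -(eigenvalue_map toC) -/AC -[toC a]da.
  (* Row [i] of [P] is an eigenvector for [d 0 i], nonzero because [P] is invertible. *)
  apply/eigenvalueP; exists (row i P); last first.
    apply: contraTneq unitP => Pi0; rewrite -row_free_unit.
    by apply/row_freePn; exists i; rewrite Pi0 sub0mx.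
  rewrite defAC -mulmxA -row_mul !mulmxA mulmxV // mul1mx.
  by rewrite row_mul row_diag_mx -scalemxAl -rowE.
(* Coordinates of [x] in the unitary eigenbasis: both sides become sums of squared moduli of [y],
   weighted by [d] on the left and by the constant [c] on the right. *)
pose y := map_mx toC x *m invmx P.
have yt : map_mx Num.conj y^T = P *m map_mx toC x^T.
  rewrite trmx_mul map_mxM conj_toC invP -map_trmx trmxK.
  by rewrite -map_mx_comp (map_mx_id (@conjCK _)).
have quadE (e : 'rV[R[i]]_n) :
    (map_mx toC x *m (invmx P *m diag_mx e *m P) *m map_mx toC x^T) 0 0
    = \sum_i e 0 i * (`|y 0 i| ^+ 2).
  rewrite !mulmxA -/y -mulmxA -yt mxE; apply: eq_bigr => i _.
  by rewrite mul_mx_diag !mxE normCK mulrAC mulrA [e 0 i * _]mulrC mulrAC.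
rewrite -lecR.
have -> : ((x *m A *m x^T) 0 0)%:C%C
    = (map_mx toC x *m AC *m map_mx toC x^T) 0 0.
  by rewrite -!map_mxM [in RHS]mxE.
have -> : (c * (x *m x^T) 0 0)%:C%C
    = \sum_i (const_mx (toC c) : 'rV_n) 0 i * (`|y 0 i| ^+ 2).
  rewrite -quadE diag_const_mx mul_mx_scalar -scalemxAl mulVmx // -scalemxAr mulmx1.
  by rewrite -scalemxAl -map_mxM -(map_mxZ toC) [in RHS]mxE [in RHS]mxE.
rewrite defAC quadE; apply: ler_sum => i _; rewrite [const_mx _ _ _]mxE.
by apply: ler_wpM2r; [exact/exprn_ge0/normr_ge0 | exact: d_le].
Qed.

(** * Energy form of the Laplacian *)

(** Twice the Dirichlet form: ordered pairs count each edge twice, whence the factors 2 below. *)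
Definition energy (R : rcfType) (G : sgraph) (f : G -> R) : R :=
  \sum_u \sum_(v | adj u v) (f u - f v) ^+ 2.

Lemma laplacian_sym (R : rcfType) (G : sgraph) : (laplacian R G)^T = laplacian R G.
Proof.
apply/matrixP => i j; rewrite !mxE adj_sym eq_sym.
by case: eqVneq => [->|].
Qed.

(** The quadratic form sums [f u ^+ 2 - f u * f v] over ordered adjacent pairs; adding the same sum
    with [u] and [v] exchanged completes the square. *)
Lemma laplacian_energy (R : rcfType) (G : sgraph) (f : G -> R) :
  let x := \row_i f (enum_val i) in
  energy f = 2 * (x *m laplacian R G *m x^T) 0 0.
Proof.
move=> x.
have quadE : (x *m laplacian R G *m x^T) 0 0
    = \sum_u \sum_(v | adj u v) (f u ^+ 2 - f u * f v).
  rewrite mxE [RHS](reindex (@enum_val G G)) /=; last exact: onW_bij (enum_val_bij _).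
  apply: eq_bigr => j _; rewrite mxE big_distrl /=.
  under eq_bigr do rewrite !mxE.
  rewrite sumrB (sumr_const [pred v | adj _ v]).
  under eq_bigr do rewrite mulrBr mulrBl.
  rewrite sumrB; congr (_ - _).
    rewrite (bigD1 j) //= big1 => [|i /negPf->]; last by rewrite mulr0n mulr0 mul0r.
    rewrite eqxx mulr1n addr0 mulrAC -expr2 mulr_natr; congr (_ *+ _).
    by apply: eq_card => v; rewrite inE.
  rewrite [RHS]big_mkcond (reindex (@enum_val G G)) /=; last exact: onW_bij (enum_val_bij _).
  apply: eq_bigr => i _; rewrite adj_sym mulrAC mulr_natr mulrC.
  by case: ifP => _; rewrite ?mulr0n // mulr1n mulrC.
have swapE : \sum_u \sum_(v | adj u v) (f u ^+ 2 - f u * f v)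
           = \sum_u \sum_(v | adj u v) (f v ^+ 2 - f v * f u).
  rewrite (exchange_big_dep xpredT) //=; apply: eq_bigr => u _.
  by apply: eq_bigl => v; rewrite adj_sym.
rewrite quadE mulr_natl mulr2n {2}swapE -big_split; apply: eq_bigr => u _.
by rewrite -big_split; apply: eq_bigr => v _ /=; ring.
Qed.

Lemma energy_le_lambda1 (R : rcfType) (G : sgraph) (f : G -> R) :
  (0 < #|G|)%N -> energy f <= 2 * lambda1 R G * \sum_u f u ^+ 2.
Proof.
move=> /(lambda1P R)[_ le_l1]; rewrite laplacian_energy -mulrA ler_pM2l ?ltr0n //.
set x := \row_i _.
have -> : \sum_u f u ^+ 2 = (x *m x^T) 0 0.
  rewrite mxE (reindex (@enum_val G G)) /=; last exact: onW_bij (enum_val_bij _).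
  by apply: eq_bigr => i _; rewrite !mxE.
exact: rayleigh_le (laplacian_sym R G) le_l1.
Qed.

(** At an eigenvector for [lambda1 R G] the hypothesis compares [lambda1 R G] and [c] times the same
    positive squared norm. *)
Lemma lambda1_le_energy (R : rcfType) (G : sgraph) (c : R) :
    (0 < #|G|)%N -> (forall f : G -> R, energy f <= 2 * c * \sum_u f u ^+ 2) ->
  lambda1 R G <= c.
Proof.
move=> /(lambda1P R)[/eigenvalueP[x xL x0] _] le_c.
have := le_c (fun u => x 0 (enum_rank u)).
rewrite laplacian_energy -mulrA ler_pM2l ?ltr0n //.
have -> : \row_i x 0 (enum_rank (enum_val i : G)) = x.
  by apply/rowP => i; rewrite mxE enum_valK.
rewrite xL -scalemxAl mxE.
have -> : \sum_(u : G) x 0 (enum_rank u) ^+ 2 = (x *m x^T) 0 0.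
  rewrite mxE (reindex (@enum_val G G)) /=; last exact: onW_bij (enum_val_bij _).
  by apply: eq_bigr => i _; rewrite enum_valK !mxE.
rewrite ler_pM2r //.
have /rV0Pn[i xi0] := x0.
rewrite mxE (bigD1 i) //= mxE; apply: ltr_wpDr; last by rewrite -expr2 exprn_even_gt0.
by apply: sumr_ge0 => j _; rewrite mxE -expr2 sqr_ge0.
Qed.

Lemma lambda1_ge0 (R : rcfType) (G : sgraph) : (0 < #|G|)%N -> 0 <= lambda1 R G.
Proof. by move=> G0; apply: (lambda1P R G0).2; apply: eigenvalue_laplacian0. Qed.

(** * Lower bounds from test functions *)

(** Test function: [d] at [v], -1 on its neighbours, 0 elsewhere. Its squared norm is d(d+1), and
    the edges at [v] alone contribute 2d(d+1)^2 to the energy. *)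
Lemma degree_lt_lambda1 (R : rcfType) (G : sgraph) (v : G) :
  (0 < degree v)%N -> (degree v).+1%:R <= lambda1 R G.
Proof.
move=> d0; set d := degree v in d0 *.
have G0 : (0 < #|G|)%N by apply/card_gt0P; exists v.
pose f u : R := if u == v then d%:R else - (adj v u)%:R.
have fv : f v = d%:R by rewrite /f eqxx.
have fN u : adj v u -> f u = -1.
  by rewrite /f; case: eqVneq => [->|_ ->//]; rewrite adj_irrefl.
have dE : \sum_(u | adj v u) (1 : R) = d%:R.
  by rewrite sumr_const; congr (_ *+ _); apply: eq_card => u; rewrite inE.
have normE : \sum_u f u ^+ 2 = d%:R * (d%:R + 1).
  rewrite (bigD1 v) //= fv mulrDr mulr1 -expr2; congr (_ + _).
  rewrite -dE [RHS]big_mkcond [RHS](bigD1 v) //= adj_irrefl add0r.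
  apply: eq_bigr => u /negPf; rewrite /f => ->.
  by case: (adj v u); rewrite sqrrN ?expr1n ?expr0n.
have energy_ge : 2 * (d%:R * (d%:R + 1) ^+ 2) <= energy f.
  have rowE : \sum_(u | adj v u) (f v - f u) ^+ 2 = d%:R * (d%:R + 1) ^+ 2.
    rewrite -{1}dE big_distrl; apply: eq_bigr => u /fN ->.
    by rewrite /= fv opprK mul1r.
  rewrite /energy (bigD1 v) //= rowE mulr_natl mulr2n lerD2l -rowE.
  (* From the other rows, keep only the edge from each neighbour back to [v]. *)
  rewrite big_mkcond [leRHS](bigID (adj v)) /= -[leLHS]addr0; apply: lerD.
    rewrite -big_mkcond [leRHS](eq_bigl (adj v)); last first.
      by move=> u; case: eqVneq => [->|]; rewrite ?adj_irrefl.
    apply: ler_sum => u vu; rewrite (bigD1 v) 1?adj_sym //= -[leLHS]addr0 -sqrrN opprB.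
    by apply: lerD => //; apply: sumr_ge0 => w _; apply: sqr_ge0.
  by apply: sumr_ge0 => u _; apply: sumr_ge0 => w _; apply: sqr_ge0.
have := le_trans energy_ge (energy_le_lambda1 f G0); rewrite normE -natr1.
have d_gt0 : 0 < d%:R :> R by rewrite ltr0n.
by nra.
Qed.

Definition cut (G : sgraph) (S : {set G}) : nat :=
  \sum_(u in S) #|[set v | adj u v] :\: S|.

(** The function equal to [t] on [S] and [- s] off [S] jumps by n = [#|G|] across the cut only: its
    energy is 2 n^2 c(S), its squared norm n s t. Cancelling 2n gives the bound. *)
Lemma cut_le_lambda1 (R : rcfType) (G : sgraph) (S : {set G}) :
  (0 < #|S|)%N -> (0 < #|~: S|)%N ->
  (#|G| * cut S)%:R <= lambda1 R G * (#|S| * #|~: S|)%:R.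
Proof.
move=> s0 t0; have nE : #|G| = (#|S| + #|~: S|)%N by rewrite cardsC.
have G0 : (0 < #|G|)%N by rewrite nE addn_gt0 s0.
set s := #|S| in s0 nE *; set t := #|~: S| in t0 nE *.
pose f u : R := if u \in S then t%:R else - s%:R.
have normE : \sum_u f u ^+ 2 = #|G|%:R * (s * t)%:R.
  rewrite (bigID [in S]) /=.
  under eq_bigr => u uS do rewrite /f uS.
  under [X in _ + X]eq_bigr => u /negPf uS do rewrite /f uS.
  rewrite !sumr_const -/s; have -> : #|[pred u | u \notin S]| = t.
    by apply: eq_card => u; rewrite !inE.
  by rewrite -[_ *+ s]mulr_natr -[_ *+ t]mulr_natr nE natrM natrD; ring.
have rowS u : u \in S ->
    \sum_(v | adj u v) (f u - f v) ^+ 2 = #|G|%:R ^+ 2 * #|[set v | adj u v] :\: S|%:R.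
  move=> uS; rewrite mulr_natr -sumr_const [RHS]big_mkcond [LHS]big_mkcond.
  apply: eq_bigr => v _; rewrite /f uS !inE; case: (v \in S) => /=.
    by case: ifP; rewrite // subrr expr0n.
  by rewrite opprK nE natrD addrC.
(* Rows outside [S] see the cut edges from the other end; exchanging the sums brings them back to
   [cut S]. *)
have rowC : \sum_(u | u \notin S) \sum_(v | adj u v) (f u - f v) ^+ 2
    = #|G|%:R ^+ 2 * (cut S)%:R.
  transitivity (\sum_(u | u \notin S) \sum_(v | adj u v && (v \in S)) #|G|%:R ^+ 2 : R).
    apply: eq_bigr => u /negPf uS; rewrite big_mkcondr; apply: eq_bigr => v _.
    rewrite /f uS; case: ifP => _; last by rewrite subrr expr0n.
    by rewrite -opprD sqrrN nE natrD.
  rewrite (exchange_big_dep [in S]) /=; last by move=> u v _ /andP[].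
  rewrite /cut natr_sum big_distrr; apply: eq_bigr => u uS.
  rewrite sumr_const /= mulr_natr; congr (_ *+ _); apply: eq_card => v.
  by rewrite unfold_in /= !inE uS adj_sym; case: (v \in S); case: (adj u v).
have energyE : energy f = 2 * (#|G|%:R ^+ 2 * (cut S)%:R).
  rewrite /energy (bigID [in S]) /= rowC (eq_bigr _ rowS) -big_distrr -natr_sum.
  by rewrite mulr_natl mulr2n.
have := energy_le_lambda1 f G0; rewrite energyE normE [(#|G| * _)%:R]natrM.
have n0 : 0 < #|G|%:R :> R by rewrite ltr0n.
have -> : 2 * lambda1 R G * (#|G|%:R * (s * t)%:R)
  = (2 * #|G|%:R) * (lambda1 R G * (s * t)%:R) by ring.
have -> : 2 * (#|G|%:R ^+ 2 * (cut S)%:R)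
  = (2 * #|G|%:R) * (#|G|%:R * (cut S)%:R) :> R by ring.
by rewrite ler_pM2l // mulr_gt0 ?ltr0n.
Qed.

(** * Degree sums and the spectrum of two cliques *)

(** Handshake: the degrees count ordered adjacent pairs, and exactly two of these lie over each
    edge. *)
Lemma sum_degree (G : sgraph) : (\sum_(u : G) degree u = 2 * #|edges G|)%N.
Proof.
pose A := [set p : G * G | adj p.1 p.2].
have -> : (\sum_(u : G) degree u = #|A|)%N.
  rewrite -sum1_card /degree; under eq_bigr do rewrite -sum1_card.
  by rewrite pair_big_dep; apply: eq_bigl => -[u v]; rewrite !inE.
rewrite -sum1_card (partition_big_imset (fun p => [set p.1; p.2])) /=.
rewrite mulnC -sum_nat_const; apply: eq_bigr => e.
case/imsetP => -[u v]; rewrite inE /= => uv ->.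
have uNv : u != v by apply: contraTneq uv => ->; rewrite adj_irrefl.
have <- : #|[set (u, v); (v, u)]| = 2%N by rewrite cards2 xpair_eqE negb_and uNv.
rewrite -sum1_card; apply: eq_bigl => -[a b]; rewrite !inE /= !xpair_eqE.
apply/andP/orP => [[ab /eqP/setP abE]|[]/andP[/eqP-> /eqP->]]; last first.
- by rewrite adj_sym uv setUC.
- by rewrite uv.
have aNb : a != b by apply: contraTneq ab => ->; rewrite adj_irrefl.
have /set2P aE : a \in [set u; v] by rewrite -abE set21.
have /set2P bE : b \in [set u; v] by rewrite -abE set22.
move: aNb; case: aE => ->; case: bE => ->; rewrite !eqxx // => _.
  by left.
by right.
Qed.

Lemma energy_complete (R : rcfType) k (f : complete_graph k -> R) :
  energy f <= 2 * k%:R * \sum_u f u ^+ 2.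
Proof.
have -> : energy f = 2 * k%:R * \sum_u f u ^+ 2 - 2 * (\sum_u f u) ^+ 2.
  (* Diagonal terms vanish, so the sum may run over all pairs. *)
  transitivity (\sum_(u : 'I_k) \sum_(v : 'I_k) (f u ^+ 2 + f v ^+ 2 - 2 * (f u * f v))).
    apply: eq_bigr => u _; rewrite big_mkcond; apply: eq_bigr => v _.
    by rewrite /= /complete_rel; case: eqVneq => [->|_]; [ring | rewrite /=; ring].
  set Q := \sum_u f u ^+ 2; set F := \sum_u f u.
  have rowE (u : 'I_k) : \sum_(v : 'I_k) (f u ^+ 2 + f v ^+ 2 - 2 * (f u * f v))
      = k%:R * f u ^+ 2 + Q - 2 * F * f u.
    rewrite sumrB big_split sumr_const card_ord -!big_distrr /= -/Q -/F mulr_natl.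
    by congr (_ - _); ring.
  rewrite (eq_bigr _ (fun u _ => rowE u)) sumrB big_split sumr_const card_ord.
  by rewrite -!big_distrr /= -/Q -/F -mulr_natl; ring.
by rewrite gerBl mulr_ge0 ?sqr_ge0.
Qed.

Lemma energy_union (R : rcfType) (G H : sgraph) (f : disjoint_union G H -> R) :
  energy f = energy (fun u : G => f (inl u)) + energy (fun u : H => f (inr u)).
Proof.
rewrite /energy big_sumType; congr (_ + _); apply: eq_bigr => u _;
  rewrite big_mkcond big_sumType /= -!big_mkcond sumr_const mul0rn.
  by rewrite addr0.
by rewrite add0r.
Qed.

Lemma lambda1_two_complete (R : rcfType) (k l : nat) : (0 < l)%N -> (k <= l)%N ->
  lambda1 R (disjoint_union (complete_graph k) (complete_graph l)) <= l%:R.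
Proof.
move=> l0 kl; apply: lambda1_le_energy.
  by rewrite card_union !card_ord addn_gt0 l0 orbT.
move=> f; rewrite energy_union big_sumType mulrDr.
apply: lerD; last exact: energy_complete.
apply: le_trans (energy_complete _) _; rewrite -!mulrA ler_pM2l ?ltr0n //.
by apply: ler_wpM2r; [apply: sumr_ge0 => u _; exact: sqr_ge0 | rewrite ler_nat].
Qed.

Lemma lambda1_edgeless (R : rcfType) (G : sgraph) :
  (0 < #|G|)%N -> #|edges G| = 0%N -> lambda1 R G <= 0.
Proof.
move=> G0 /eqP/[!cards_eq0]/eqP noE; apply: lambda1_le_energy => // f.
rewrite mulr0 mul0r /energy big1 // => u _; rewrite big_pred0 // => v.
apply/negP => uv; suff : [set u; v] \in edges G by rewrite noE inE.
by apply/imsetP; exists (u, v); rewrite ?inE.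
Qed.

(** * Triangles and 4-cycles in small regular graphs *)

Section RegularRelation.
Variables (T : finType) (e : rel T).
Hypotheses (e_sym : symmetric e) (e_irr : irreflexive e).
Let N u := [set v | e u v].

(** Without triangles, adjacent [u] and [v] have disjoint neighbourhoods covering all vertices but
    one, [w]. Then [N w] lies in [N u :|: N v] and meets both parts, which forces each intersection
    to have at most one element; but [w] has 4 neighbours. *)
Lemma triangle_of_regular4_card9 :
    #|T| = 9%N -> (forall u, #|N u| = 4%N) ->
  exists x y z, [/\ e x y, e y z & e x z].
Proof.
move=> T9 N4.
have [/existsP[x /existsP[y /existsP[z /and3P[]]]]|noTri] :=
    boolP [exists x, exists y, exists z, [&& e x y, e y z & e x z]].
  by exists x, y, z.
have disjN x y : e x y -> N x :&: N y = set0.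
  move=> xy; apply/setP => z; rewrite !inE; apply: contraNF noTri => /andP[xz yz].
  apply/existsP; exists x; apply/existsP; exists y; apply/existsP; exists z.
  by rewrite xy yz.
have /card_gt0P[u _] : (0 < #|T|)%N by rewrite T9.
have /card_gt0P[v] : (0 < #|N u|)%N by rewrite N4.
rewrite inE => uv.
have /cards1P[w wE] : #|~: (N u :|: N v)| == 1%N.
  by apply/eqP; have := cardsC (N u :|: N v); rewrite cardsU disjN // cards0 !N4 T9; lia.
have Nw z : e w z -> e u z || e v z.
  move=> wz; apply: contraTT wz; rewrite negb_or => zN.
  have : z \in ~: (N u :|: N v) by rewrite !inE negb_or.
  by rewrite wE inE => /eqP->; rewrite e_irr.
have wNuv : ~~ e u w && ~~ e v w.
  have : w \in ~: (N u :|: N v) by rewrite wE inE.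
  by rewrite !inE negb_or.
(* [N x] misses [N a :|: N w], which thus has at most 9 - 4 = 5 elements; it contains the 4 of [N a]
   and, disjoint from them, [N w :&: N b]. *)
have few a b x : e a b -> e w x -> e a x -> (#|N w :&: N b| <= 1)%N.
  move=> ab wx ax; have xa : e x a by rewrite e_sym.
  have xw : e x w by rewrite e_sym.
  have x_aw : N x :&: (N a :|: N w) = set0 by rewrite setIUr !disjN // setU0.
  have a_wb : N a :&: (N w :&: N b) = set0 by rewrite setICA disjN // setI0.
  have := max_card [in N x :|: (N a :|: N w)].
  rewrite cardsU x_aw cards0 N4 T9.
  have : (#|N a :|: (N w :&: N b)| <= #|N a :|: N w|)%N.
    by apply/subset_leq_card/setUS/subsetIl.
  by rewrite cardsU a_wb cards0 N4; lia.
(* If [N w] missed [N b], it would equal [N a] by cardinality and so contain [b]. *)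
have meets a b : e a b -> ~~ e b w -> (forall z, e w z -> e a z || e b z) ->
    (0 < #|N w :&: N b|)%N.
  move=> ab bw Nab; rewrite lt0n; apply: contra bw => /eqP/cards0_eq wb0.
  have wa : N w \subset N a.
    apply/subsetP => z; rewrite !inE => wz; have /orP[//|bz] := Nab z wz.
    by move/setP/(_ z): wb0; rewrite !inE wz bz.
  have /eqP : N w == N a by rewrite eqEcard wa !N4.
  by move/setP/(_ b); rewrite !inE ab e_sym => ->.
have vu : e v u by rewrite e_sym.
have Nw' z : e w z -> e v z || e u z by rewrite orbC; exact: Nw.
have /andP[uw vw] := wNuv.
have /card_gt0P[y] := meets _ _ uv vw Nw; rewrite !inE => /andP[wy vy].
have /card_gt0P[x] := meets _ _ vu uw Nw'; rewrite !inE => /andP[wx ux].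
have := few _ _ _ vu wy vy; have := few _ _ _ uv wx ux.
have : (#|(N w :&: N u) :|: (N w :&: N v)| = 4)%N.
  rewrite -setIUr (setIidPl _) ?N4 //; apply/subsetP => z; rewrite !inE; exact: Nw.
by rewrite cardsU; lia.
Qed.

(** Each of the 3 neighbours of [v] has 2 further neighbours, all among the 4 vertices outside
    [v |: N v] as there is no triangle. With no 4-cycle through [v] these pairs would be disjoint,
    giving 6 vertices among 4. *)
Lemma four_cycle_of_regular3_card8 :
    #|T| = 8%N -> (forall u, #|N u| = 3%N) ->
    (forall x y z, e x y -> e y z -> ~~ e x z) ->
  exists v p x q, [/\ [&& e v p, e p x, e x q & e q v], v != x & p != q].
Proof.
move=> T8 N3 noTri.
have /card_gt0P[v _] : (0 < #|T|)%N by rewrite T8.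
have [/existsP[p /existsP[q /existsP[x]]]|no] := boolP [exists p, exists q, exists x,
    [&& e v p, e v q, p != q, e p x, e q x & v != x]].
  case/and5P => vp vq pq px /andP[qx vx].
  by exists v, p, x, q; rewrite vp px e_sym qx e_sym vq.
have N_disj p q : e v p -> e v q -> p != q -> (N p :\ v) :&: (N q :\ v) = set0.
  move=> vp vq pq; apply/setP => x; rewrite !inE; apply: contraNF no.
  move=> /andP[/andP[xv px] /andP[_ qx]].
  apply/existsP; exists p; apply/existsP; exists q; apply/existsP; exists x.
  by rewrite vp vq pq px qx eq_sym xv.
have N_out p : e v p -> N p :\ v \subset ~: (v |: N v).
  move=> vp; apply/subsetP => x; rewrite !inE => /andP[xv px].
  by rewrite negb_or xv (noTri v p).
have N2 p : e v p -> #|N p :\ v| = 2%N.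
  by move=> vp; have := cardsD1 v (N p); rewrite N3 inE e_sym vp; lia.
have out4 : #|~: (v |: N v)| = 4%N.
  by have := cardsC (v |: N v); rewrite cardsU1 inE e_irr N3 T8; lia.
have /card_gt0P[p] : (0 < #|N v|)%N by rewrite N3.
rewrite inE => vp.
have : (1 < #|N v :\ p|)%N by have := cardsD1 p (N v); rewrite N3 inE vp; lia.
case/card_gt1P => q [r []]; rewrite !inE => /andP[qp vq] /andP[rp vr] qr.
have : (N p :\ v) :|: (N q :\ v) :|: (N r :\ v) \subset ~: (v |: N v).
  by rewrite !subUset !N_out.
move/subset_leq_card; rewrite out4 cardsU setIUl !N_disj // 1?eq_sym // setU0 cards0.
by rewrite cardsU N_disj // 1?eq_sym // cards0 !N2.
Qed.
End RegularRelation.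

(** * The 4-regular graphs on 8 or 9 vertices *)

Lemma cut_independent (G : sgraph) (S : {set G}) (d : nat) :
    {in S &, forall u v, ~~ adj u v} -> (forall u : G, degree u = d) ->
  cut S = (#|S| * d)%N.
Proof.
move=> indS deg_d; rewrite /cut -sum_nat_const; apply: eq_bigr => u uS.
rewrite -(deg_d u) /degree; apply: eq_card => v; rewrite !inE.
by case: (boolP (v \in S)) => // vS; rewrite (negPf (indS u v uS vS)).
Qed.

(* Balanced cuts of the complement graph e: if e has a triangle S, then S is
   independent in G and its cut has 12 edges; otherwise e is cubic on 8 vertices
   and a 4-cycle of e induces a matching in G, so its cut has 12 edges as well. *)
Lemma lambda1_regular4 (R : rcfType) (G : sgraph) :
    #|G| = 8%N \/ #|G| = 9%N -> (forall u : G, degree u = 4%N) ->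
  6%:R <= lambda1 R G.
Proof.
move=> G89 deg4.
(* With 12 cut edges the bound n c(S) / (|S| |V \ S|) is 96/15, 108/18 or 96/16, never below 6. *)
have cut_bound (S : {set G}) : (#|S| = 3)%N \/ (#|S| = 4 /\ #|G| = 8)%N ->
    (12 <= cut S)%N -> 6%:R <= lambda1 R G.
  move=> S34 cut12; have SC := cardsC S.
  have := @cut_le_lambda1 R G S.
  have -> : (#|~: S| = #|G| - #|S|)%N by rewrite -SC addKn.
  rewrite !natrM => bound.
  have cut12R : 12%:R <= (cut S)%:R :> R by rewrite ler_nat.
  by case: S34 => [S3|[S4 G8]]; [case: G89 => G8|]; move: bound;
    rewrite ?S3 ?S4 G8 !subSS subn0 => /(_ isT isT); lra.
pose e (u v : G) := (u != v) && ~~ adj u v.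
have e_sym : symmetric e by move=> u v; rewrite /e eq_sym adj_sym.
have e_irr : irreflexive e by move=> u; rewrite /e eqxx.
have cardN u : #|[set v | e u v]| = (#|G| - 5)%N.
  have -> : [set v | e u v] = ~: (u |: [set v | adj u v]).
    by apply/setP => v; rewrite !inE negb_or eq_sym.
  have := cardsC (u |: [set v | adj u v]).
  by rewrite cardsU1 inE adj_irrefl -/(degree u) deg4; lia.
have eN u v : e u v -> adj u v = false by case/andP => _ /negPf.
have triple x y z : e x y -> e y z -> e x z -> 6%:R <= lambda1 R G.
  move=> xy yz xz; pose S := x |: [set y; z].
  have S3 : #|S| = 3%N.
    rewrite cardsU1 cards2 !inE; move: xy yz xz.
    by rewrite /e => /andP[/negPf-> _] /andP[/negPf-> _] /andP[/negPf-> _].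
  apply: (cut_bound S); first by left.
  rewrite (@cut_independent _ S 4) ?S3 // => u v; rewrite !inE.
  have N := (eN _ _ xy, eN _ _ yz, eN _ _ xz).
  by case/or3P => /eqP->; case/or3P => /eqP->; rewrite ?adj_irrefl ?N // adj_sym N.
have [/existsP[x /existsP[y /existsP[z /and3P[]]]]|noTri] :=
    boolP [exists x, exists y, exists z, [&& e x y, e y z & e x z]].
  exact: triple.
case: G89 => Gn; last first.
  have [u|x [y [z [xy yz xz]]]] := triangle_of_regular4_card9 e_sym e_irr Gn.
    by rewrite cardN Gn.
  exact: triple xy yz xz.
have [u|x y z xy yz|v [p [x [q [/and4P[vp px xq qv] vx pq]]]]] :=
    four_cycle_of_regular3_card8 e_sym e_irr Gn.
- by rewrite cardN Gn.
- apply: contra noTri => xz; apply/existsP; exists x; apply/existsP; exists y.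
  by apply/existsP; exists z; rewrite xy yz.
have rot4 (a b c d : G) : [set a; b; c; d] = [set b; c; d; a].
  by rewrite -!setUA setUC !setUA.
(* [b] and [d] are the neighbours of [a] on the 4-cycle of [e], so within [S] only the opposite
   vertex [c] can be adjacent to [a] in [G]. *)
have few (S : {set G}) (a b c d : G) : e a b -> e a d -> S = [set a; b; c; d] ->
    (3 <= #|[set w | adj a w] :\: S|)%N.
  move=> ab ad ->; have := cardsID [set a; b; c; d] [set w | adj a w].
  rewrite -/(degree a) deg4.
  suff : (#|[set w | adj a w] :&: [set a; b; c; d]| <= 1)%N by lia.
  rewrite -(cards1 c); apply/subset_leq_card/subsetP => w; rewrite !inE -!orbA.
  case/andP => aw /or4P[] // /eqP wE; move: aw; rewrite wE ?adj_irrefl //.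
    by rewrite (eN _ _ ab).
  by rewrite (eN _ _ ad).
have [pv xp qx vq] : [/\ e p v, e x p, e q x & e v q].
  by split; rewrite e_sym.
pose S := [set v; p; x; q].
have uS : uniq [:: v; p; x; q].
  rewrite /= !inE !negb_or vx pq.
  move: vp px xq vq.
  by rewrite /e => /andP[-> _] /andP[-> _] /andP[-> _] /andP[-> _].
have SE : S =i [:: v; p; x; q] by move=> u; rewrite !inE -!orbA.
apply: (cut_bound S); first by right; split=> //; rewrite (eq_card SE); exact/card_uniqP.
rewrite /cut (eq_bigl _ _ SE) -big_uniq // !big_cons big_nil.
have Sv := few S v p x q vp vq erefl.
have Sp := few S p x q v px pv (rot4 _ _ _ _).
have Sx : (3 <= #|[set w | adj x w] :\: S|)%N.
  by apply: (few S x q v p xq xp); rewrite /S rot4 rot4.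
have Sq := few S q v p x qv qx (esym (rot4 _ _ _ _)).
exact: leq_add Sv (leq_add Sp (leq_add Sx (leq_trans Sq (leq_addr _ _)))).
Qed.

(** * Arithmetic of the parameters and conclusion *)

Lemma double_bin2 k : (2 * 'C(k, 2) = k * k.-1)%N.
Proof. by rewrite mulnC -[2%N in LHS]/(2`!)%N bin_ffact ffactnS ffactn1. Qed.

Lemma extremal_parameters (n l : nat) : (0 < l)%N -> (n * l = n + 2 * l ^ 2)%N ->
  (n = 8 /\ l = 2)%N \/ (n = 9 /\ l = 3)%N.
Proof.
case: l => // j _ eq_nl.
(* This is n (l - 1) = 2 l^2 with [l = j + 1]; every term except the final 2 is a multiple of
   [j]. *)
have nj : (n * j = 2 * j ^ 2 + 4 * j + 2)%N by nia.
have : (j %| 2)%N.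
  rewrite -(@dvdn_addr (2 * j ^ 2 + 4 * j)) -?nj ?dvdn_mull //.
  by rewrite dvdn_add ?dvdn_mull // expnS dvdn_mulr.
rewrite dvdn_divisors // !inE => /orP[]/eqP jE; subst j; lia.
Qed.

(** Both inequalities compare sides with the same difference, up to sign: l(l-1) + k(k-1) -
    (l+k)(k-2) = l + k + 2l^2 - (l+k)l. One makes it nonnegative, the other nonpositive. *)
Lemma degree_sum_extremal (l k : nat) : (0 < l)%N -> (1 < k)%N ->
    ((l + k) * l <= l + k + 2 * l ^ 2)%N ->
    (l * l.-1 + k * k.-1 <= (l + k) * (k - 2))%N ->
  (l * l.-1 + k * k.-1 = (l + k) * (k - 2))%N /\
  ((l + k) * l = l + k + 2 * l ^ 2)%N.
Proof. by case: l => // a _; case: k => [|[|b]] // _; rewrite !subSS subn0 /=; lia. Qed.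

Theorem theorem4p1 (R : rcfType) (n l : nat)
    (n_gt0 : (0 < n)%N) (l_gt0 : (0 < l)%N)
    (l_le_half : l%:R <= n%:R / 2%:R :> R)
    (hyp : l%:R - 2%:R * l%:R ^+ 2 / n%:R <= 1 :> R) :
  LEGM R (disjoint_union (complete_graph l) (complete_graph (n - l))).
Proof.
have n0R : 0 < n%:R :> R by rewrite ltr0n.
have ln : (2 * l <= n)%N by rewrite -(ler_nat R) natrM; lra.
have hypN : (n * l <= n + 2 * l ^ 2)%N.
  have /(ler_wpM2l (ltW n0R)) := hyp.
  have -> : n%:R * (l%:R - 2 * l%:R ^+ 2 / n%:R) = n%:R * l%:R - 2 * l%:R ^+ 2 :> R.
    by field; rewrite gt_eqF.
  by rewrite mulr1 lerBlDr -natrX -!natrM -natrD ler_nat.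
move=> H; rewrite card_union !card_ord subnKC; last by lia.
move=> cardH edgesH; set k := (n - l)%N.
have H0 : (0 < #|H|)%N by rewrite cardH.
(* When [k <= 1], also [l = k = 1] and there are no edges. This case is separate because [k - 2]
   truncates and the degree bound needs an edge. *)
have [k_le1|k_gt1] := leqP k 1.
  apply: le_trans (lambda1_ge0 R H0); apply: lambda1_edgeless.
    by rewrite card_union !card_ord; lia.
  by rewrite card_edges_two_complete !bin_small; lia.
apply: (@le_trans _ _ k%:R); first by apply: lambda1_two_complete; lia.
have [/existsP[v dv]|small] := boolP [exists v : H, (k.-1 <= degree v)%N].
  apply: le_trans (degree_lt_lambda1 R (v := v) _); last by lia.
  by rewrite ler_nat; lia.
have deg_le (v : H) : (degree v <= k - 2)%N.
  by move: small; rewrite negb_exists => /forallP/(_ v); lia.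
have sumE : (\sum_(v : H) degree v = l * l.-1 + k * k.-1)%N.
  by rewrite sum_degree edgesH card_edges_two_complete mulnDr !double_bin2.
have nE : n = (l + k)%N by rewrite /k; lia.
have sum_constE : (\sum_(v : H) (k - 2) = (l + k) * (k - 2))%N.
  by rewrite sum_nat_const cardH nE.
have hypk : ((l + k) * l <= l + k + 2 * l ^ 2)%N by rewrite -nE.
have [|eq_sum extremal] := degree_sum_extremal l_gt0 k_gt1 hypk.
  by rewrite -sumE -sum_constE; exact: leq_sum.
rewrite -nE in extremal.
(* The degree sum attains its upper bound, so every degree does. *)
have deg_eq (v : H) : degree v = (k - 2)%N.
  have [_] := leqif_sum (fun v (_ : xpredT v) => leqif_eq (deg_le v)).
  by rewrite sumE eq_sum sum_constE eqxx => /esym/forallP/(_ v)/eqP.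
have [[n8 l2]|[n9 l3]] := extremal_parameters l_gt0 extremal.
  have -> : k = 6%N by lia.
  by apply: lambda1_regular4; [left; lia | move=> v; rewrite deg_eq; lia].
have -> : k = 6%N by lia.
by apply: lambda1_regular4; [right; lia | move=> v; rewrite deg_eq; lia].
Qed.
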